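(* Let $n>1$ be a fixed integer and define, for real $x>1$, $$\mathcal{L}(x) := \left( \sum_{k=1}^{n} \pi(x/k) \right)^2 - \frac{ex}{\log x} \left( \sum_{k=1}^{n} \pi(x/(ek)) \right).$$ Then, as $x\to\infty$, $$\mathcal{L}(x) = O\left(\frac{x^2}{(\log x)^2}\right),$$ and $\mathcal{L}(x)>0$ for all sufficiently large $x$.
   Context: For real $y>0$, $\pi(y)$ denotes the number of primes less than or equal to $y$; $\log$ is the natural logarithm and $e$ is its base. *)

(* Defs.v *)
From mathcomp Require Import all_boot all_order all_algebra.
From mathcomp Require Import all_classical all_reals all_analysis.

Set Implicit Arguments.
Unset Strict Implicit.
Unset Printing Implicit Defensive.

Import Order.TTheory GRing.Theory Num.Theory.
Import numFieldNormedType.Exports.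

Local Open Scope ring_scope.

(* [Num.truncn y] is the floor of [y] when [0 <= y] (and [0] otherwise), so the
   primes below are exactly those [p] with [p%:R <= y]. *)
Definition primepi {R : realType} (y : R) : nat :=
  count prime (iota 0 (Num.truncn y).+1).

Definition calL {R : realType} (n : nat) (x : R) : R :=
  (\sum_(1 <= k < n.+1) (primepi (x / k%:R))%:R) ^+ 2
  - expR 1 * x / ln x
    * \sum_(1 <= k < n.+1) (primepi (x / (expR 1 * k%:R)))%:R.

(* The filter packaging that the notation [f =O_F g] requires; the library
   provides it for [nbhs x] and [\oo] but not for the neighbourhoods of +oo. *)
Canonical pinfty_nbhs_filter_on (R : numFieldType) :=
  FilterType (pinfty_nbhs R) _.

(* Main.v *)
Require Import Defs.
From mathcomp Require Import all_boot all_order all_algebra.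
From mathcomp Require Import all_classical all_reals all_analysis.
From mathcomp Require Import ring lra zify.

Import Order.TTheory GRing.Theory Num.Theory.
Import numFieldNormedType.Exports.

Local Open Scope classical_set_scope.
Local Open Scope ring_scope.

Set Implicit Arguments.
Unset Strict Implicit.

(** Write [H] for the sum of the [1/k] with [1 <= k <= n].  If
    [c y / ln y <= pi(y) <= C y / ln y] for large [y], then the first term of
    [calL n x] is at least [(c H x / ln x)^2], while the subtracted term is at
    most [C H (x / ln x)^2] after an arbitrarily small increase of [C], the
    factors [e] cancelling.  So [calL n x] is eventually positive as soon as
    [C < c^2 H], and then it is also at most the square of the first sum, which
    is [O((x / ln x)^2)].  With the prime number theorem [c] and [C] may be
    taken arbitrarily close to 1, and [1 < H] suffices.  That theorem is far
    stronger than what is needed: since [3/2 <= H], it is enough to have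
    [C < 3/2 c^2], and Chebyshev's elementary bounds, which allow any [c < A]
    and any [C > 6/5 A] for
    [A = ln (2^(1/2) 3^(1/3) 5^(1/5) / 30^(1/30)) = 0.92...], provide this
    because [4/5 < A].

    Chebyshev's bounds come from the quotient
    [u = N! (N/30)! / ((N/2)! (N/3)! (N/5)!)] of factorials of floors.  By
    Legendre's formula the exponent of a prime [p] in [u] is the sum over [k]
    of [E(floor (N / p^k))], where
    [E(m) = m + m/30 - m/2 - m/3 - m/5] (with floors) only takes the values 0
    and 1, and is 1 for [1 <= m <= 5].  Hence [p]'s contribution to [u] is at
    most [N], so [ln u <= pi(N) ln N] (lemma [ln_cheb_quot_le]); and every
    prime in [(N/6, N]] divides [u], so
    [(pi(N) - pi(N/6)) ln (N/6) <= ln u] (lemma [ln_cheb_quot_ge]).  A crude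
    form of Stirling's formula gives [ln u = A N + O(ln N)] (lemma
    [ln_cheb_quot_approx]).  The lower bound on [pi] is then immediate, and
    summing the other inequality over the scales [x, x/6, x/36, ...] produces
    the geometric series [1 + 1/6 + 1/36 + ... = 6/5] of the upper bound. *)

(** * Chebyshev's quotient of factorials *)

Definition cheb_floor (m : nat) : nat :=
  (m + m %/ 30 - (m %/ 2 + m %/ 3 + m %/ 5))%N.

(** Since [1 + 1/30 = 1/2 + 1/3 + 1/5], this function is periodic of period
    30, which leaves finitely many cases. *)
Lemma cheb_floor_le1 (m : nat) : (cheb_floor m <= 1)%N.
Proof. rewrite /cheb_floor; lia. Qed.

Lemma cheb_floor_eq1 (m : nat) : (0 < m < 6)%N -> cheb_floor m = 1%N.
Proof. by case: m => [|[|[|[|[|[|m]]]]]]. Qed.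

(** The subtraction in [cheb_floor] never truncates. *)
Lemma cheb_floor_eq (m : nat) :
  (m + m %/ 30 = m %/ 2 + m %/ 3 + m %/ 5 + cheb_floor m)%N.
Proof. rewrite /cheb_floor; lia. Qed.

Lemma ln_prod_pos (R : realType) (I : Type) (r : seq I) (P : pred I)
    (F : I -> R) : (forall i, P i -> 0 < F i) ->
  ln (\prod_(i <- r | P i) F i) = \sum_(i <- r | P i) ln (F i).
Proof.
move=> F_gt0.
suff [] : 0 < \prod_(i <- r | P i) F i /\
  ln (\prod_(i <- r | P i) F i) = \sum_(i <- r | P i) ln (F i) by [].
elim/big_rec2: _ => [|i s q Pi [q_gt0 <-]]; first by rewrite ln1.
by rewrite lnM ?posrE ?F_gt0// mulr_gt0 ?F_gt0.
Qed.

(** Letting [p] range up to a bound [N] that does not depend on [m] allows the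
    factorials of [N], [N/2], [N/3], [N/5] and [N/30] to be combined prime by
    prime; [logn_fact_widen] serves the same purpose for the exponents. *)
Lemma ln_fact_logn (R : realType) (N m : nat) : (m <= N)%N ->
  ln (m`!%:R : R) =
  \sum_(0 <= p < N.+1 | prime p) (logn p m`!)%:R * ln (p%:R : R).
Proof.
elim: m => [_|m IHm ltmN].
  by rewrite fact0 ln1 big1 // => p _; rewrite logn1 mul0r.
have ln_nat (j : nat) : (0 < j <= N)%N -> ln (j%:R : R) =
    \sum_(0 <= p < N.+1 | prime p) (logn p j)%:R * ln (p%:R : R).
  move=> /andP[j_gt0 lejN].
  rewrite -{1}(partnT j_gt0) (widen_partn _ lejN) natr_prod.
  rewrite (bigID prime)/= [X in _ * X]big1 ?mulr1; last first.
    by move=> p /negPf pN; rewrite lognE pN expn0.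
  rewrite ln_prod_pos => [|p /prime_gt0 p_gt0].
    apply: eq_bigr => p /prime_gt0 p_gt0.
    by rewrite natrX lnXn ?ltr0n// mulr_natl.
  by rewrite ltr0n expn_gt0 p_gt0.
rewrite factS natrM lnM ?posrE ?ltr0n ?fact_gt0// (IHm (ltnW ltmN)).
rewrite ln_nat// -big_split/=; apply: eq_bigr => p p_pr.
by rewrite lognM ?fact_gt0// natrD mulrDl.
Qed.

Lemma logn_fact_widen (p N m : nat) : prime p -> (m <= N)%N ->
  logn p m`! = (\sum_(1 <= k < N.+1) m %/ p ^ k)%N.
Proof.
move=> p_pr lemN; rewrite logn_fact// [RHS](@big_cat_nat _ _ _ m.+1)//=.
rewrite [X in (_ + X)%N]big_nat_cond [X in (_ + X)%N]big1 ?addn0// => k.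
rewrite andbT => /andP[ltmk _]; apply: divn_small.
by apply: ltn_trans ltmk _; apply/ltn_expl/prime_gt1.
Qed.

Definition ln_cheb_quot (R : realType) (N : nat) : R :=
  ln N`!%:R + ln (N %/ 30)`!%:R
  - (ln (N %/ 2)`!%:R + ln (N %/ 3)`!%:R + ln (N %/ 5)`!%:R).

(** Legendre's formula: the floors of [N/d] and of [N/p^k] commute, so the five
    exponents combine into [cheb_floor] evaluated at the floor of [N/p^k]. *)
Lemma ln_cheb_quotE (R : realType) (N : nat) :
  ln_cheb_quot R N = \sum_(0 <= p < N.+1 | prime p)
    (\sum_(1 <= k < N.+1) cheb_floor (N %/ p ^ k))%:R * ln (p%:R : R).
Proof.
rewrite /ln_cheb_quot !(@ln_fact_logn R N) ?leq_div//.
apply/eqP; rewrite subr_eq; apply/eqP; rewrite -!big_split/=.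
apply: eq_bigr => p p_pr; rewrite -!mulrDl -!natrD.
congr (_%:R * _); rewrite !(@logn_fact_widen p N) ?leq_div// -!big_split/=.
apply: eq_bigr => k _.
have divAC d : (N %/ d %/ p ^ k = N %/ p ^ k %/ d)%N.
  by rewrite -!divnMA mulnC.
by rewrite !divAC cheb_floor_eq addnC.
Qed.

Definition primecount (N : nat) : nat := count prime (iota 0 N.+1).

Lemma primecountE (R : realType) (N : nat) :
  (primecount N)%:R = \sum_(0 <= p < N.+1 | prime p) (1 : R).
Proof. by rewrite /primecount -sum1_count natr_sum /index_iota subn0. Qed.

(** Only the [k] with [p^k <= N] contribute to the exponent of [p], each by at
    most 1, so that the [p]-part of the quotient is at most [N]. *)
Lemma ln_cheb_quot_le (R : realType) (N : nat) :
  ln_cheb_quot R N <= (primecount N)%:R * ln (N%:R : R).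
Proof.
rewrite ln_cheb_quotE primecountE mulr_suml big_nat_cond [leRHS]big_nat_cond.
apply: ler_sum => p /andP[/andP[_ lepN] p_pr].
have N_gt0 : (0 < N)%N by apply: leq_trans (prime_gt0 p_pr) _; rewrite -ltnS.
have p_gt1 := prime_gt1 p_pr.
rewrite mul1r.
have tN : (trunc_log p N <= N)%N.
  exact: ltnW (leq_trans (ltn_expl _ p_gt1) (trunc_logP p_gt1 N_gt0)).
apply: (@le_trans _ _ ((trunc_log p N)%:R * ln p%:R)).
  apply: ler_wpM2r; first by rewrite ln_ge0// ler1n ltnW.
  rewrite ler_nat (@big_cat_nat _ _ _ (trunc_log p N).+1)//=.
  rewrite [X in (_ + X <= _)%N]big_nat_cond [X in (_ + X <= _)%N]big1.
    rewrite addn0; apply: (@leq_trans (\sum_(1 <= k < (trunc_log p N).+1) 1)%N).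
      by apply: leq_sum => k _; apply: cheb_floor_le1.
    by rewrite sum_nat_const_nat muln1 subSS subn0.
  move=> k /andP[/andP[ltk _] _]; rewrite divn_small//.
  by apply: (leq_trans (trunc_log_ltn N p_gt1)); rewrite leq_exp2l.
rewrite mulr_natl -lnXn ?ltr0n ?prime_gt0// -natrX ler_ln ?posrE ?ltr0n//.
  by rewrite ler_nat trunc_logP.
by rewrite expn_gt0 prime_gt0.
Qed.

(** A prime [p] with [N/6 < p <= N] has [1 <= floor (N/p) <= 5], so the [k = 1]
    term of its exponent is 1.  Having [N + 1] instead of [N] in the
    logarithm makes the result usable at any real [x] with floor [N]. *)
Lemma ln_cheb_quot_ge (R : realType) (N : nat) : (6 <= N)%N ->
  ((primecount N)%:R - (primecount (N %/ 6))%:R) * ln (N.+1%:R / 6 : R)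
    <= ln_cheb_quot R N.
Proof.
move=> N_ge6; have N6 : ((N %/ 6).+1 <= N.+1)%N by rewrite ltnS leq_div.
rewrite ln_cheb_quotE !primecountE.
rewrite [X in X - _](@big_cat_nat _ _ _ (N %/ 6).+1)//= addrAC subrr add0r.
rewrite [leRHS](@big_cat_nat _ _ _ (N %/ 6).+1)//= ler_wpDl//.
  apply: sumr_ge0 => p /prime_gt0 p_gt0.
  by rewrite mulr_ge0// ln_ge0// ler1n.
rewrite mulr_suml [leLHS]big_nat_cond [leRHS]big_nat_cond.
apply: ler_sum => p /andP[/andP[ltNp lepN] p_pr].
have p_gt0 := prime_gt0 p_pr.
have lnp : ln (N.+1%:R / 6 : R) <= ln p%:R.
  rewrite ler_ln ?posrE ?divr_gt0 ?ltr0n// ler_pdivrMr ?ltr0n//.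
  by rewrite -natrM ler_nat; move: ltNp; lia.
apply: ler_pM => //.
  by rewrite ln_ge0// ler_pdivlMr ?ltr0n// mul1r (ler_nat _ 6) leqW.
rewrite ler1n big_ltn ?expn1; last by lia.
by rewrite cheb_floor_eq1 ?addSn// divn_gt0// ltn_divLR//; move: ltNp lepN; lia.
Qed.

(** * A weak Stirling formula *)

(** The antiderivative of [ln]. *)
Definition xlnx {R : realType} (x : R) : R := x * ln x - x.

Lemma ln_le_subr1 (R : realType) (x : R) : 0 < x -> ln x <= x - 1.
Proof.
by move=> x_gt0; rewrite -{1}(subrKC 1 x) le_ln1Dx// ltrBrDl subrr.
Qed.

(** Convexity of [xlnx].  Exchanging [a] and [b] gives the matching upper bound
    [xlnx b - xlnx a <= (b - a) * ln b], so this single lemma replaces the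
    comparison of [ln (m!)] with an integral. *)
Lemma xlnx_tangent (R : realType) (a b : R) : 0 < a -> 0 < b ->
  (b - a) * ln a <= xlnx b - xlnx a.
Proof.
move=> a_gt0 b_gt0; have := ln_le_subr1 (divr_gt0 a_gt0 b_gt0).
rewrite ln_div ?posrE// -(ler_pM2l b_gt0) [leRHS]mulrBr mulr1.
rewrite mulrCA divff ?gt_eqF// mulr1.
rewrite /xlnx; nra.
Qed.

Lemma ln_fact_bounds (R : realType) (m : nat) : (0 < m)%N ->
  xlnx (m%:R : R) + 1 <= ln (m`!%:R : R) <= xlnx m%:R + 1 + ln (m%:R : R).
Proof.
elim: m => // -[|m] IHm _.
  by rewrite (_ : 1`! = 1)%N// /xlnx ln1 mulr0 sub0r addNr addr0 lexx.
have {IHm} /andP[lo hi] := IHm isT.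
have m_gt0 : 0 < m.+1%:R :> R by rewrite ltr0n.
have m1_gt0 : 0 < m.+2%:R :> R by rewrite ltr0n.
have t1 := xlnx_tangent m_gt0 m1_gt0; have t2 := xlnx_tangent m1_gt0 m_gt0.
have mE : m.+2%:R = m.+1%:R + 1 :> R by rewrite -natr1.
rewrite factS natrM lnM ?posrE ?ltr0n ?fact_gt0//.
rewrite {1}mE in t1; rewrite {1}mE in t2.
by apply/andP; split; lra.
Qed.

(** The form in which Stirling's formula is applied, with [m] the floor of [y]:
    replacing [m] by [y] costs no more than the error already present. *)
Lemma ln_fact_approx (R : realType) (m : nat) (y : R) : (0 < m)%N ->
  m%:R <= y <= m.+1%:R -> `|ln m`!%:R - xlnx y| <= 1 + ln y.
Proof.
move=> m_gt0 /andP[lemy leym].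
have M_ge1 : 1 <= m%:R :> R by rewrite ler1n.
have M_gt0 : 0 < m%:R :> R by rewrite ltr0n.
have y_gt0 : 0 < y by apply: lt_le_trans lemy.
have /andP[lo hi] := ln_fact_bounds R m_gt0.
have t1 := xlnx_tangent M_gt0 y_gt0; have t2 := xlnx_tangent y_gt0 M_gt0.
have lnm : 0 <= ln m%:R :> R by rewrite ln_ge0.
have lny : ln m%:R <= ln y by rewrite ler_ln ?posrE.
have ym : y - m%:R <= 1 by rewrite lerBlDl natr1.
have p1 : 0 <= (y - m%:R) * ln m%:R by rewrite mulr_ge0 ?subr_ge0.
have p2 : (y - m%:R) * ln y <= ln y.
  by rewrite ler_piMl// (le_trans lnm).
rewrite ler_norml; apply/andP; split; lra.
Qed.

(** Chebyshev's constant [ln 2 / 2 + ln 3 / 3 + ln 5 / 5 - ln 30 / 30]. *)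
Definition cheb_const (R : realType) : R :=
  (14 * ln 2 + 9 * ln 3 + 5 * ln 5) / 30.

(** The main terms [N ln N] and [N] cancel because
    [1 + 1/30 = 1/2 + 1/3 + 1/5]; the parts [(N/d) ln d] remain. *)
Lemma ln_cheb_quot_approx (R : realType) (N : nat) : (30 <= N)%N ->
  `|ln_cheb_quot R N - cheb_const R * N%:R| <= 5 * (1 + ln N%:R).
Proof.
move=> N_ge30.
have N_gt0 : 0 < N%:R :> R by rewrite ltr0n; lia.
have approx k : (0 < k <= 30)%N -> `|ln (N %/ k)`!%:R -
   (N%:R / k%:R * (ln N%:R - ln k%:R) - N%:R / k%:R)| <= 1 + ln (N%:R : R).
  move=> /andP[k_gt0 k_le]; have K_gt0 : 0 < k%:R :> R by rewrite ltr0n.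
  rewrite -ln_div ?posrE//; apply: le_trans (ln_fact_approx _ _) _.
  - by rewrite divn_gt0// (leq_trans k_le).
  - rewrite ler_pdivlMr// ler_pdivrMr// -!natrM !ler_nat.
    by rewrite leq_divM/= ltnW// -ltn_divLR.
  rewrite lerD2l ler_ln ?posrE ?divr_gt0// ler_pdivrMr//.
  by rewrite ler_peMr ?ler1n// ltW.
have a1 := approx 1%N isT; have a2 := approx 2%N isT.
have a3 := approx 3%N isT; have a5 := approx 5%N isT.
have a30 := approx 30%N isT.
rewrite divn1 ln1 subr0 in a1.
have l30 : ln 30 = ln 2 + ln 3 + ln 5 :> R.
  by rewrite -!lnM ?posrE ?mulr_gt0//; congr ln; ring.
rewrite l30 in a30.
rewrite /ln_cheb_quot /cheb_const; move: a1 a2 a3 a5 a30; rewrite !ler_norml.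
set L := ln N%:R; set l2 := ln 2; set l3 := ln 3; set l5 := ln 5.
move=> /andP[? ?] /andP[? ?] /andP[? ?] /andP[? ?] /andP[? ?].
apply/andP; split; lra.
Qed.

(** The bound [1 - 1/t <= ln t] is sharp enough for [t = 16/15], [25/24] and
    [81/80], and [ln 2], [ln 3], [ln 5] are integral combinations of the
    logarithms of these three fractions. *)
Lemma cheb_const_gt (R : realType) : 4 / 5 < cheb_const R.
Proof.
have ln_frac (a b : R) : 0 < a -> 0 < b -> (a - b) / a <= ln a - ln b.
  move=> a_gt0 b_gt0; rewrite -ln_div ?posrE//.
  rewrite -[leRHS]opprK -lnV ?posrE ?divr_gt0// invf_div lerNr.
  apply: le_trans (ln_le_subr1 _) _; first by rewrite divr_gt0.
  by rewrite mulrBl divff ?gt_eqF// opprB.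
have h1 : 1 / 16 <= 4 * ln 2 - ln 3 - ln 5 :> R.
  have := ln_frac (2 ^+ 4) (3 * 5); rewrite lnXn// lnM ?posrE// => h.
  by have := h ltac:(lra) ltac:(lra); lra.
have h2 : 1 / 25 <= 2 * ln 5 - 3 * ln 2 - ln 3 :> R.
  have := ln_frac (5 ^+ 2) (2 ^+ 3 * 3); rewrite lnM ?posrE ?exprn_gt0//.
  rewrite !lnXn// => h.
  by have := h ltac:(lra) ltac:(lra); lra.
have h3 : 1 / 81 <= 4 * ln 3 - 4 * ln 2 - ln 5 :> R.
  have := ln_frac (3 ^+ 4) (2 ^+ 4 * 5); rewrite lnM ?posrE ?exprn_gt0//.
  rewrite !lnXn// => h.
  by have := h ltac:(lra) ltac:(lra); lra.
rewrite /cheb_const; lra.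
Qed.

(** * Comparisons near infinity *)

(** From [ln (t x) <= t x - 1] with [t] so small that [b * (t x)] is at most
    [eta / 2 * x]. *)
Lemma ln_near_le_linear (R : realType) (a b eta : R) : 0 < b -> 0 < eta ->
  \forall x \near +oo_R, a + b * ln x <= eta * x.
Proof.
move=> b_gt0 eta_gt0; pose t := eta / (2 * b).
have t_gt0 : 0 < t by rewrite divr_gt0// mulr_gt0.
near=> x.
have x_gt0 : 0 < x by near: x; exact: nbhs_pinfty_gt (num_real _).
have x_ge : (a - b * (1 + ln t)) / (eta / 2) <= x.
  by near: x; exact: nbhs_pinfty_ge (num_real _).
have := ln_le_subr1 (mulr_gt0 t_gt0 x_gt0).
rewrite lnM ?posrE// -(ler_pM2l b_gt0).
rewrite [X in _ <= X](_ : _ = eta / 2 * x - b); last first.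
  by rewrite /t; field; rewrite gt_eqF.
by move: x_ge; rewrite ler_pdivrMr ?divr_gt0//; lra.
Unshelve. all: by end_near. Qed.

Lemma ln_near_ge (R : realType) (a : R) : \forall x \near +oo_R, a <= ln x.
Proof.
near=> x.
have leax : expR a <= x by near: x; exact: nbhs_pinfty_ge (num_real _).
have x_gt0 : 0 < x := lt_le_trans (expR_gt0 a) leax.
by rewrite -[leLHS]expRK ler_ln ?posrE ?expR_gt0.
Unshelve. all: by end_near. Qed.

Lemma near_pinfty_div (R : realType) (d : R) (P : R -> Prop) : 0 < d ->
  (\forall y \near +oo_R, P y) -> \forall x \near +oo_R, P (x / d).
Proof.
move=> d_gt0 [M [_ MP]]; near=> x.
have ltMx : M * d < x by near: x; exact: nbhs_pinfty_gt (num_real _).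
by apply: MP; rewrite ltr_pdivlMr.
Unshelve. all: by end_near. Qed.

Lemma near_ler_sum_nat (R : realType) (f g : nat -> R -> R) (n : nat) :
  (forall k, (0 < k)%N -> \forall x \near +oo_R, f k x <= g k x) ->
  \forall x \near +oo_R,
    \sum_(1 <= k < n.+1) f k x <= \sum_(1 <= k < n.+1) g k x.
Proof.
move=> fg; elim: n => [|n IHn].
  by apply: filterE => x; rewrite !big_geq.
near=> x; rewrite big_nat_recr//= [leRHS]big_nat_recr//=; apply: lerD.
  by near: x.
by near: x; exact: fg.
Unshelve. all: by end_near. Qed.

(** * Chebyshev's bounds for the number of primes *)

Lemma le_primecount (m n : nat) :
  (m <= n)%N -> (primecount m <= primecount n)%N.
Proof.
by move=> lemn; rewrite /primecount -(subnKC lemn) -addSn iotaD count_cat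
  leq_addr.
Qed.

Lemma le_primepi (R : realType) (x y : R) :
  x <= y -> (primepi x <= primepi y)%N.
Proof. by move=> lexy; apply/le_primecount/le_truncn. Qed.

Lemma cheb_const_gt0 (R : realType) : 0 < cheb_const R.
Proof. by apply: lt_trans (cheb_const_gt R); lra. Qed.

Lemma primepi_ge (R : realType) (c : R) : c < cheb_const R ->
  \forall x \near +oo_R, c * (x / ln x) <= (primepi x)%:R.
Proof.
move=> ltcA; have A_gt0 := cheb_const_gt0 R; near=> x.
have x_ge : 30 <= x by near: x; exact: nbhs_pinfty_ge (num_real _).
have dom : (cheb_const R + 5) + 5 * ln x <= (cheb_const R - c) * x.
  by near: x; apply: ln_near_le_linear; rewrite ?subr_gt0.
have x_ge0 : 0 <= x by lra.
have /andP[leNx ltxN] := truncn_itv x_ge0; rewrite -natr1 in ltxN.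
have N_ge : (30 <= Num.truncn x)%N by rewrite truncn_ge_nat.
have N_gt0 : 0 < (Num.truncn x)%:R :> R by rewrite ltr0n; lia.
have lnN : ln (Num.truncn x)%:R <= ln x by rewrite ler_ln ?posrE//; lra.
have lnx_gt0 : 0 < ln x by rewrite ln_gt0//; lra.
rewrite mulrA ler_pdivrMr//.
have := ln_cheb_quot_approx R N_ge; rewrite ler_norml => /andP[lo _].
have up := ln_cheb_quot_le R (Num.truncn x).
have : (primepi x)%:R * ln (Num.truncn x)%:R <= (primepi x)%:R * ln x.
  exact: ler_wpM2l.
rewrite {1}/primepi -/(primecount _).
have : cheb_const R * (x - 1) <= cheb_const R * (Num.truncn x)%:R.
  by rewrite ler_pM2l//; lra.
lra.
Unshelve. all: by end_near. Qed.

Lemma primepi_step (R : realType) (a : R) : cheb_const R < a ->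
  \forall x \near +oo_R,
    ((primepi x)%:R - (primepi (x / 6))%:R) * ln (x / 6) <= a * x.
Proof.
move=> ltAa; have A_gt0 := cheb_const_gt0 R; near=> x.
have x_ge : 30 <= x by near: x; exact: nbhs_pinfty_ge (num_real _).
have dom : 5 + 5 * ln x <= (a - cheb_const R) * x.
  by near: x; apply: ln_near_le_linear; rewrite ?subr_gt0.
have x_ge0 : 0 <= x by lra.
have /andP[leNx ltxN] := truncn_itv x_ge0.
set N := Num.truncn x in leNx ltxN.
have N_ge : (30 <= N)%N by rewrite truncn_ge_nat.
have N_gt0 : 0 < N%:R :> R by rewrite ltr0n; lia.
have lnN : ln N%:R <= ln x by rewrite ler_ln ?posrE//; lra.
have N6 : (primecount (N %/ 6) <= primepi (x / 6))%N.
  apply: le_primecount; rewrite truncn_ge_nat ?divr_ge0//.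
  rewrite ler_pdivlMr// -natrM; apply: le_trans leNx.
  by rewrite ler_nat leq_divM.
have NN6 : (primecount (N %/ 6) <= primecount N)%N.
  by apply: le_primecount; apply: leq_div.
have ln6_ge0 : 0 <= ln (x / 6) by rewrite ln_ge0// ler_pdivlMr//; lra.
have ln6 : ln (x / 6) <= ln (N.+1%:R / 6).
  by rewrite ler_ln ?posrE ?divr_gt0 ?ltr0n//; lra.
have := ln_cheb_quot_approx R N_ge; rewrite ler_norml => /andP[_ hi].
have low := @ln_cheb_quot_ge R N (leq_trans (isT : 6 <= 30)%N N_ge).
have AN : cheb_const R * N%:R <= cheb_const R * x by rewrite ler_pM2l.
apply: (@le_trans _ _ (ln_cheb_quot R N)); last by lra.
apply: le_trans low.
apply: (@le_trans _ _
    (((primecount N)%:R - (primecount (N %/ 6))%:R) * ln (x / 6))).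
  by apply: ler_wpM2r => //; rewrite lerD2l lerN2 ler_nat.
by apply: ler_wpM2l => //; rewrite subr_ge0 ler_nat.
Unshelve. all: by end_near. Qed.

(** Iteration of [primepi_step].  Adding the bound for [x / 6] to the step
    yields [(C/6 + a) x / ln (x/6)], which is at most [C x / ln x] for large [x]
    as soon as [C/6 + a < C]; this is where the factor [6/5] comes from.  The
    constant [K] absorbs the range in which [x] is not yet large, so that the
    inequality holds on the whole range needed for the induction. *)
Lemma primepi_le_addr (R : realType) (C : R) : 6 / 5 * cheb_const R < C ->
  exists K : R, forall x, 2 <= x -> (primepi x)%:R <= C * (x / ln x) + K.
Proof.
move=> ltAC; have A_gt0 := cheb_const_gt0 R; have C_gt0 : 0 < C by lra.
(* Strictly between [cheb_const R], as [primepi_step] requires, and [5/6 C]. *)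
pose a := (cheb_const R + 5 / 6 * C) / 2.
have ltAa : cheb_const R < a by rewrite /a; lra.
have gap : 0 < 5 / 6 * C - a by rewrite /a; lra.
have [M [_ MP]] : \forall x \near +oo_R,
    ((primepi x)%:R - (primepi (x / 6))%:R) * ln (x / 6) <= a * x /\
    C * ln 6 / (5 / 6 * C - a) <= ln x.
  by apply: filterI; [exact: primepi_step|exact: ln_near_ge].
pose X := Num.max M 12; exists (primepi X)%:R => x0 x0_ge2.
have lnx_gt0 (x : R) : 2 <= x -> 0 < ln x by move=> ?; rewrite ln_gt0//; lra.
have small (x : R) : 2 <= x -> x <= X ->
    (primepi x)%:R <= C * (x / ln x) + (primepi X)%:R.
  move=> x_ge2 lexX; apply: (@le_trans _ _ (primepi X)%:R).
    by rewrite ler_nat le_primepi.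
  by rewrite lerDr mulr_ge0 ?divr_ge0 ?(ltW (lnx_gt0 _ _))//; lra.
(* Induction on the distance to [X]: for [x > X >= 12], dividing by 6 lowers
   [x] by more than 1. *)
have : x0 <= X + (Num.truncn x0).+1%:R.
  have : 12 <= X by rewrite le_max lexx orbT.
  by have := truncnS_gt x0; lra.
move: (Num.truncn x0).+1 => m; elim: m x0 x0_ge2 => [|n IHn] x x_ge2.
  by rewrite addr0; exact: small.
have [lexX _|ltXx lexn] := leP x X; first exact: small.
have [ltMx x_gt12] : M < x /\ 12 < x.
  by move: ltXx; rewrite gt_max => /andP[].
have [step lnx_ge] := MP _ ltMx.
have x6_ge2 : 2 <= x / 6 by lra.
have := IHn _ x6_ge2; rewrite -natr1 in lexn.
move=> /(_ ltac:(lra)) IH; have lnx := lnx_gt0 _ x_ge2.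
have ln6x := lnx_gt0 _ x6_ge2.
rewrite -ler_pdivlMr// in step.
suff : C * (x / 6 / ln (x / 6)) + a * x / ln (x / 6) <= C * (x / ln x) by lra.
rewrite [leLHS](_ : _ = x * ((C / 6 + a) / ln (x / 6))); last first.
  by field; rewrite gt_eqF.
rewrite [leRHS]mulrCA ler_pM2l; last by lra.
rewrite ler_pdivrMr// mulrAC ler_pdivlMr// ln_div ?posrE//; last by lra.
by move: lnx_ge; rewrite ler_pdivrMr//; lra.
Qed.

(** Dividing by [ln x] rather than [ln (x / d)] lets the bounds for several [d]
    be added up.  Both this change and the additive constant of
    [primepi_le_addr] are paid for by a slight increase of the constant, in two
    steps [C1 < C2 < C]. *)
Lemma primepi_div_le (R : realType) (C d : R) :
  6 / 5 * cheb_const R < C -> 0 < d ->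
  \forall x \near +oo_R, (primepi (x / d))%:R <= C * (x / d / ln x).
Proof.
move=> ltAC d_gt0; have A_gt0 := cheb_const_gt0 R.
pose C1 := (2 * (6 / 5 * cheb_const R) + C) / 3; pose C2 := (C1 + C) / 2.
have C1C2 : 0 < C2 - C1 by rewrite /C2 /C1; lra.
have C2C : 0 < C - C2 by rewrite /C2 /C1; lra.
have ltAC1 : 6 / 5 * cheb_const R < C1 by rewrite /C1; lra.
have [K HK] := primepi_le_addr ltAC1.
have K1_gt0 : 0 < 1 + `|K| by rewrite ltr_pwDl.
near=> x.
have x_gt1 : 1 < x by near: x; exact: nbhs_pinfty_gt (num_real _).
have xd_ge : 2 <= x / d.
  near: x; apply: (@near_pinfty_div R d (fun y => 2 <= y)) => //.
  exact: nbhs_pinfty_ge (num_real _).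
have lnx : 0 < ln x by rewrite ln_gt0.
have lnxd : 0 < ln (x / d) by rewrite ln_gt0//; lra.
have dom : 0 + (1 + `|K|) * ln x <= ((C - C2) / d) * x.
  by near: x; apply: ln_near_le_linear; rewrite ?divr_gt0.
have cmp : C2 * ln d / (C2 - C1) <= ln x by near: x; exact: ln_near_ge.
apply: le_trans (HK _ xd_ge) _.
have x_gt0 : 0 < x by lra.
have y_gt0 : 0 < x / d by lra.
have h1 : C1 * (x / d / ln (x / d)) <= C2 * (x / d / ln x).
  rewrite mulrCA [leRHS]mulrCA ler_pM2l//.
  rewrite ler_pdivrMr// mulrAC ler_pdivlMr// ln_div ?posrE//.
  by move: cmp; rewrite ler_pdivrMr//; lra.
have h2 : K <= (C - C2) * (x / d / ln x).
  rewrite mulrA ler_pdivlMr//.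
  have : K * ln x <= `|K| * ln x by rewrite ler_pM2r// ler_norm.
  by move: dom; rewrite mulrAC -mulrA; lra.
lra.
Unshelve. all: by end_near. Qed.

(** Here [ln (x / d) <= ln x], so replacing the logarithm only weakens the
    bound. *)
Lemma primepi_div_ge (R : realType) (c d : R) :
  0 <= c < cheb_const R -> 1 <= d ->
  \forall x \near +oo_R, c * (x / d / ln x) <= (primepi (x / d))%:R.
Proof.
move=> /andP[c_ge0 ltcA] d_ge1; have d_gt0 : 0 < d by lra.
near=> x.
have xd_gt1 : 1 < x / d.
  near: x; apply: (@near_pinfty_div R d (fun y => 1 < y)) => //.
  exact: nbhs_pinfty_gt (num_real _).
have x_ge0 : 0 <= x by near: x; exact: nbhs_pinfty_ge (num_real _).
have lexd : x / d <= x by rewrite ler_pdivrMr// ler_peMr.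
have low : c * (x / d / ln (x / d)) <= (primepi (x / d))%:R.
  near: x; apply: (@near_pinfty_div R d
    (fun y => c * (y / ln y) <= (primepi y)%:R)) => //.
  exact: primepi_ge.
apply: le_trans low; apply: ler_wpM2l => //; apply: ler_wpM2l; first by lra.
by rewrite lef_pV2 ?posrE ?ln_gt0// ?ler_ln ?posrE//; lra.
Unshelve. all: by end_near. Qed.

(** * The sign and the size of [calL] *)

Unset Implicit Arguments.

Theorem theorem4p1 (R : realType) (n : nat) (hn : (1 < n)%N) :
  ((calL n : R -> R) =O_ (+oo_R) (fun x => x ^+ 2 / ln x ^+ 2)) /\
  (\forall x \near +oo_R, 0 < calL n x).
Proof.
pose H : R := \sum_(1 <= k < n.+1) k%:R^-1.
have H_ge : 3 / 2 <= H.
  rewrite /H big_ltn ?ltnS ?(ltnW hn)// big_ltn// invr1 addrA.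
  have : 0 <= \sum_(3 <= k < n.+1) k%:R^-1 :> R.
    by apply: sumr_ge0 => k _; rewrite invr_ge0.
  lra.
pose A := cheb_const R; have A_gt : 4 / 5 < A := cheb_const_gt R.
(* As [C - 6/5 A] and [3/2 c^2 - 6/5 A] are respectively equal to [1/2]
   and greater than [3/4] of [(A - 4/5) A], this choice leaves [C < 3/2 c^2]. *)
pose c := A - (A - 4 / 5) / 4; pose C := 6 / 5 * A + (A - 4 / 5) * A / 2.
have c_bnd : 0 <= c < A by rewrite /c; apply/andP; split; lra.
have ltAC : 6 / 5 * A < C.
  have : 0 < (A - 4 / 5) * A by apply: mulr_gt0; lra.
  by rewrite /C; lra.
have key : C < c ^+ 2 * H.
  apply: (@lt_le_trans _ _ (c ^+ 2 * (3 / 2))); last first.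
    by apply: ler_wpM2l; rewrite ?sqr_ge0.
  by rewrite /C /c; nra.
pose S (x : R) : R := \sum_(1 <= k < n.+1) (primepi (x / k%:R))%:R.
pose S' (x : R) : R :=
  \sum_(1 <= k < n.+1) (primepi (x / (expR 1 * k%:R)))%:R.
have bounds : \forall x \near +oo_R, [/\ 0 < x / ln x,
    c * H * (x / ln x) <= S x, S x <= C * H * (x / ln x) &
    S' x <= C * H * (x / ln x) / expR 1].
  have E (b d : R) x : b * H * (x / ln x) / d =
     \sum_(1 <= k < n.+1) b * (x / (d * k%:R) / ln x).
    rewrite /H mulr_sumr !mulr_suml; apply: eq_bigr => k _.
    rewrite invfM; ring.
  have E1 (b : R) x : b * H * (x / ln x) =
     \sum_(1 <= k < n.+1) b * (x / k%:R / ln x).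
    by rewrite -[LHS]divr1 E; apply: eq_bigr => k _; rewrite mul1r.
  near=> x; split.
  - have x_gt1 : 1 < x by near: x; exact: nbhs_pinfty_gt (num_real _).
    by rewrite divr_gt0 ?ln_gt0//; lra.
  - rewrite E1; near: x; apply: near_ler_sum_nat => k k_gt0.
    by apply: primepi_div_ge; rewrite ?ler1n.
  - rewrite E1; near: x; apply: near_ler_sum_nat => k k_gt0.
    by apply: primepi_div_le; rewrite ?ltr0n.
  - rewrite E; near: x; apply: near_ler_sum_nat => k k_gt0.
    by apply: primepi_div_le; rewrite ?mulr_gt0 ?expR_gt0 ?ltr0n.
have pos : \forall x \near +oo_R, 0 < calL n x.
  apply: filterS bounds => x [t_gt0 Slo _ S'hi].
  rewrite /calL subr_gt0 -/(S x) -/(S' x).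
  set t := x / ln x in t_gt0 Slo S'hi *.
  have e_gt0 := @expR_gt0 R 1.
  rewrite -[expR 1 * x / ln x]mulrA -/t; clearbody t.
  apply: (@le_lt_trans _ _ (C * H * t ^+ 2)).
    rewrite (_ : C * H * t ^+ 2 = expR 1 * t * (C * H * t / expR 1)).
      by apply: ler_wpM2l => //; rewrite mulr_ge0// ltW.
    by field; rewrite gt_eqF.
  apply: (@lt_le_trans _ _ ((c * H * t) ^+ 2)).
    rewrite !exprMn ltr_pM2r ?exprn_gt0// expr2 mulrA ltr_pM2r//; lra.
  rewrite ler_sqr ?nnegrE//; last first.
    by apply: le_trans Slo; rewrite !mulr_ge0; lra.
  by rewrite !mulr_ge0//; lra.
(* As [calL n x] is positive, it is bounded by its first term alone. *)
split=> //; apply/eqO_exP; exists ((C * H) ^+ 2).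
  by rewrite exprn_gt0// mulr_gt0; lra.
near=> x.
have x_pos : 0 < calL n x by near: x.
have [t_gt0 _ Shi _] : [/\ 0 < x / ln x,
    c * H * (x / ln x) <= S x, S x <= C * H * (x / ln x) &
    S' x <= C * H * (x / ln x) / expR 1] by near: x.
have S_ge0 : 0 <= S x by apply: sumr_ge0 => k _.
rewrite gtr0_norm// -expr_div_n ger0_norm ?sqr_ge0// -exprMn.
rewrite /calL -/(S x) lerBlDr.
apply: ler_wpDr.
  apply: mulr_ge0; last by apply: sumr_ge0 => k _.
  by rewrite -mulrA mulr_ge0 ?expR_ge0// ltW.
rewrite ler_sqr// nnegrE; exact: le_trans Shi.
Unshelve. all: by end_near. Qed.
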